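(* Let $E$ be a number field, $G$ a finite group, $\mathcal{A}$ an $\mathcal{O}_E$-order of full rank in the group algebra $A = E[G]$, and $\mathcal{M}$ a maximal $\mathcal{O}_E$-order in $A$ containing $\mathcal{A}$. Let $X$ be an $\mathcal{A}$-lattice and let $d$ be a positive integer. Then $X$ is free of rank $d$ over $\mathcal{A}$ if and only if both of the following hold: (a) $X$ is a locally free $\mathcal{A}$-lattice of rank $d$; and (b) there exist $\alpha_1,\ldots,\alpha_d \in X$ such that $\mathcal{M}X = \mathcal{M}\alpha_1 \oplus \cdots \oplus \mathcal{M}\alpha_d$. Further, when this is the case (i.e. (a) holds and $\alpha_1,\ldots,\alpha_d\in X$ are as in (b)), $X = \mathcal{A}\alpha_1 \oplus \cdots \oplus \mathcal{A}\alpha_d$.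
   Context: $\mathcal{O}_E$ is the ring of integers of $E$. ''Module'' means left module. An $\mathcal{A}$-lattice is a left $\mathcal{A}$-module that is finitely generated and torsion-free over $\mathcal{O}_E$. For a prime $\mathfrak{p}$ of $\mathcal{O}_E$ and an $\mathcal{O}_E$-module $M$, $M_{\mathfrak{p}} := \mathcal{O}_{E,\mathfrak{p}} \otimes_{\mathcal{O}_E} M$ is the localization. $X$ is locally free of rank $d$ if for every prime $\mathfrak{p}$ of $\mathcal{O}_E$ the $\mathcal{A}_{\mathfrak{p}}$-module $X_{\mathfrak{p}}$ is free of rank $d$. For an $\mathcal{A}$-lattice $X$, $\mathcal{M}X$ denotes $\mathcal{M}\otimes_{\mathcal{A}} X$ identified with the sublattice of the $E$-vector space $E \otimes_{\mathcal{O}_E} X$ generated by the products $\lambda x$ with $\lambda\in\mathcal{M}$, $x\in X$; in particular $X \subseteq \mathcal{M}X$. Direct sums are internal direct sums. *)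

(* Defs.v *)
From HB Require Import structures.
From mathcomp Require Import all_boot all_order all_fingroup all_algebra all_field.
From mathcomp Require Import ring_quotient generic_quotient.
From mathcomp Require Import ring boolp classical_sets.

Set Implicit Arguments.
Unset Strict Implicit.
Unset Printing Implicit Defensive.

Import GRing.Theory.

Local Open Scope ring_scope.
Local Open Scope quotient_scope.

(* [f : grpalg E G] is the element [\sum_(g : G) f g . g]; the product is
   therefore convolution, not the pointwise product of functions. *)
Definition grpalg (E : fieldType) (G : finGroupType) := {ffun G -> E}.

Section GroupAlgebra.
Variables (E : fieldType) (G : finGroupType).
Local Notation EG := (grpalg E G).

HB.instance Definition _ := GRing.Lmodule.copy EG {ffun G -> E^o}.

Definition grpalg_one : EG := [ffun x => (x == 1%g)%:R].
Definition grpalg_mul (f h : EG) : EG :=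
  [ffun x => \sum_(y : G) f y * h (y^-1 * x)%g].

Lemma grpalg_mulA : associative grpalg_mul.
Proof.
move=> f g h; apply/ffunP => x; rewrite !ffunE.
under [RHS]eq_bigr do rewrite ffunE mulr_suml.
rewrite exchange_big /=; apply: eq_bigr => y _.
rewrite ffunE mulr_sumr [RHS](reindex_inj (mulgI y)) /=.
by apply: eq_bigr => z _; rewrite mulKg invMg mulgA mulrA.
Qed.

Lemma grpalg_mul1 : left_id grpalg_one grpalg_mul.
Proof.
move=> f; apply/ffunP => x; rewrite ffunE (bigD1 1%g) //= ffunE eqxx invg1.
rewrite mul1g mul1r big1 ?addr0 // => y /negPf y1.
by rewrite ffunE y1 mul0r.
Qed.

Lemma grpalg_mulr1 : right_id grpalg_one grpalg_mul.
Proof.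
move=> f; apply/ffunP => x; rewrite ffunE (bigD1 x) //= ffunE mulVg eqxx.
rewrite mulr1 big1 ?addr0 // => y /negPf yx.
by rewrite ffunE -eq_invg_mul invgK yx mulr0.
Qed.

Lemma grpalg_mulDl : left_distributive grpalg_mul +%R.
Proof.
move=> f g h; apply/ffunP => x; rewrite !ffunE -big_split /=.
by apply: eq_bigr => y _; rewrite ffunE mulrDl.
Qed.

Lemma grpalg_mulDr : right_distributive grpalg_mul +%R.
Proof.
move=> f g h; apply/ffunP => x; rewrite !ffunE -big_split /=.
by apply: eq_bigr => y _; rewrite ffunE mulrDr.
Qed.

Lemma grpalg_one_neq0 : grpalg_one != 0.
Proof.
apply/eqP => /ffunP /(_ 1%g); rewrite !ffunE eqxx => /eqP.
by rewrite oner_eq0.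
Qed.

HB.instance Definition _ := GRing.Zmodule_isNzRing.Build EG
  grpalg_mulA grpalg_mul1 grpalg_mulr1 grpalg_mulDl grpalg_mulDr
  grpalg_one_neq0.

Lemma grpalg_scaleAl (a : E) (f g : EG) : a *: (f * g) = a *: f * g.
Proof.
apply/ffunP => x; rewrite !ffunE /GRing.scale /= mulr_sumr.
by apply: eq_bigr => y _; rewrite ffunE mulrA.
Qed.

Lemma grpalg_scaleAr (a : E) (f g : EG) : a *: (f * g) = f * (a *: g).
Proof.
apply/ffunP => x; rewrite !ffunE /GRing.scale /= mulr_sumr.
by apply: eq_bigr => y _; rewrite ffunE mulrCA.
Qed.

HB.instance Definition _ := GRing.Lmodule_isLalgebra.Build E EG grpalg_scaleAl.
HB.instance Definition _ := GRing.Lalgebra_isAlgebra.Build E EG grpalg_scaleAr.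

End GroupAlgebra.

Section RingOfIntegers.
Variable E : fieldExtType rat.

Definition integral_elt : {pred E} :=
  fun x => `[< integralOver (intr : int -> E) x >].

Lemma integral_eltP (x : E) :
  reflect (integralOver (intr : int -> E) x) (x \in integral_elt).
Proof. by rewrite unfold_in; apply: asboolP. Qed.

Lemma integral_elt_closed : subring_closed integral_elt.
Proof.
split=> [|x y /integral_eltP hx /integral_eltP hy|
           x y /integral_eltP hx /integral_eltP hy]; apply/integral_eltP.
- exact: integral1.
- exact: integral_sub.
- exact: integral_mul.
Qed.

HB.instance Definition _ :=
  GRing.isSubringClosed.Build E integral_elt integral_elt_closed.

Record ringInt := RingInt { intval :> E; _ : intval \in integral_elt }.

HB.instance Definition _ := [isSub for intval].
HB.instance Definition _ := [Choice of ringInt by <:].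
HB.instance Definition _ := [SubChoice_isSubComNzRing of ringInt by <:].

Lemma intr_fieldExt_eq0 (z : int) : ((z%:~R : E) == 0) = (z == 0).
Proof.
by rewrite -scaler_int scaler_eq0 oner_eq0 orbF intr_eq0.
Qed.

Lemma integral_denom (x : E) :
  exists2 s : ringInt, s != 0 & (s : E) * x \in integral_elt.
Proof.
have [q Dq] : exists q, minPoly 1%VS x = map_poly (in_alg E) q.
  by apply/polyOver1P/minPolyOver.
have [r [a nza Dr]] := rat_poly_scale q.
have nzr : r != 0.
  apply/eqP => r0; have := monic_neq0 (monic_minPoly 1%VS x).
  by rewrite Dq Dr r0 !rmorph0 scaler0 rmorph0 eqxx.
have rx : (map_poly (intr : int -> E) r).[x] = 0.
  have /eqP := minPolyxx 1%VS x.
  rewrite Dq Dr linearZ /= hornerZ mulf_eq0 -map_poly_comp /=.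
  case/orP => [|/eqP <-].
    by rewrite scaler_eq0 oner_eq0 orbF invr_eq0 intr_eq0 (negPf nza).
  by congr (_.[_]); apply: eq_map_poly => z; rewrite /= scaler_int.
have [n sz] : exists n, size r = n.+2.
  case sz: (size r) => [|[|n]]; last by exists n.
    by move/eqP: sz; rewrite size_poly_eq0 (negPf nzr).
  have /size1_polyC Er : (size r <= 1)%N by rewrite sz.
  move: rx nzr; rewrite Er map_polyC hornerC /= => /eqP.
  by rewrite intr_fieldExt_eq0 polyC_eq0 => ->.
pose c := r`_n.+1.
have nzc : c != 0.
  by move: nzr; rewrite -lead_coef_eq0 lead_coefE sz.
have cI (z : int) : z%:~R \in integral_elt by rewrite rpred_int.
exists (RingInt (cI c)).
  by apply/eqP => /(congr1 intval) /= /eqP; rewrite intr_fieldExt_eq0 (negPf nzc).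
apply/integral_eltP => /=.
pose p : {poly int} := \poly_(i < n.+1) (r`_i * c ^+ (n - i)).
exists ('X^(n.+1) + p).
  rewrite monicE lead_coefDl ?lead_coefXn ?size_polyXn ?ltnS ?size_poly //.
rewrite /root rmorphD /= map_polyXn hornerD hornerXn.
have smap : size (map_poly (intr : int -> E) r) = n.+2.
  by rewrite size_map_poly_id0 // intr_fieldExt_eq0 lead_coef_eq0.
move: rx; rewrite horner_coef smap big_ord_recr /= coef_map /= => rx.
rewrite (@horner_coef_wide _ n.+1); last first.
  by apply: leq_trans (size_poly _ _) _; apply: size_poly.
apply/eqP; rewrite -[RHS](mulr0 (c%:~R ^+ n)) -[in RHS]rx mulrDr
  [LHS]addrC mulr_sumr.
congr (_ + _); last by rewrite exprMn exprSr -mulrA.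
apply: eq_bigr => i _.
have lein : (i <= n)%N by rewrite -ltnS.
rewrite !coef_map coef_poly ltn_ord /= rmorphM rmorphXn exprMn /=.
have -> : c%:~R ^+ n = c%:~R ^+ (n - i) * c%:~R ^+ i :> E.
  by rewrite -exprD subnK.
by rewrite [RHS]mulrACA; congr (_ * _); rewrite mulrC.
Qed.

End RingOfIntegers.

Section Orders.
Variables (E : fieldExtType rat) (G : finGroupType).
Local Notation EG := (grpalg E G).
Local Notation OE := (ringInt E).

(* An [OE]-order of full rank: a unital subring of [E[G]] which is a finitely
   generated [OE]-submodule of [E[G]] spanning [E[G]] over [E]. *)
Record int_order := Order {
  order_mem :> {pred EG};
  order_subring : subring_closed order_mem;
  order_scale : forall (c : OE) (a : EG),
    a \in order_mem -> (c : E) *: a \in order_mem;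
  order_fg : exists (n : nat) (g : 'I_n -> EG),
    (forall i, g i \in order_mem) /\
    (forall a, a \in order_mem ->
       exists c : 'I_n -> OE, a = \sum_i (c i : E) *: g i);
  order_full : forall a : EG, exists (n : nat) (c : 'I_n -> E) (g : 'I_n -> EG),
    (forall i, g i \in order_mem) /\ a = \sum_i c i *: g i }.

HB.instance Definition _ (A : int_order) :=
  GRing.isSubringClosed.Build EG (order_mem A) (order_subring A).

Definition maximal_order (M : int_order) : Prop :=
  forall N : int_order, {subset M <= N} -> {subset N <= M}.

Record order_ring (A : int_order) :=
  OrderRing { order_val :> EG; _ : order_val \in A }.

HB.instance Definition _ (A : int_order) := [isSub for @order_val A].
HB.instance Definition _ (A : int_order) := [Choice of order_ring A by <:].
HB.instance Definition _ (A : int_order) :=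
  [SubChoice_isSubNzRing of order_ring A by <:].

Lemma order_scalar_subproof (A : int_order) (c : OE) :
  (c : E)%:A \in A.
Proof. by apply: order_scale; apply: rpred1. Qed.

(* The structure map [OE -> A], through which [A]-modules are [OE]-modules. *)
Definition order_scalar (A : int_order) (c : OE) : order_ring A :=
  OrderRing (order_scalar_subproof A c).

Section OrderScalar.
Variable A : int_order.

Lemma order_scalar1 : order_scalar A 1 = 1.
Proof. by apply: val_inj; rewrite /= scale1r. Qed.

Lemma order_scalarD : {morph order_scalar A : c d / c + d}.
Proof. by move=> c d; apply: val_inj; rewrite /= scalerDl. Qed.

Lemma order_scalarM : {morph order_scalar A : c d / c * d}.
Proof.
by move=> c d; apply: val_inj; rewrite /= -scalerAl mul1r scalerA.
Qed.

Lemma order_scalarC (c : OE) (a : order_ring A) :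
  order_scalar A c * a = a * order_scalar A c.
Proof.
by apply: val_inj; rewrite /= -scalerAl -scalerAr mul1r mulr1.
Qed.

End OrderScalar.

End Orders.

Section Modules.
Variables (E : fieldExtType rat) (G : finGroupType) (A : int_order E G).
Variable X : lmodType (order_ring A).

Definition scaleO (c : ringInt E) (x : X) : X := order_scalar A c *: x.

Definition fin_gen : Prop :=
  exists (n : nat) (g : 'I_n -> X), forall x : X,
    exists c : 'I_n -> ringInt E, x = \sum_i scaleO (c i) (g i).

Definition torsion_free : Prop :=
  forall (c : ringInt E) (x : X), scaleO c x = 0 -> c = 0 \/ x = 0.

Definition lattice : Prop := fin_gen /\ torsion_free.

Lemma scaleO1 x : scaleO 1 x = x.
Proof. by rewrite /scaleO order_scalar1 scale1r. Qed.

Lemma scaleOA c d x : scaleO c (scaleO d x) = scaleO (c * d) x.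
Proof. by rewrite /scaleO scalerA order_scalarM. Qed.

Lemma scaleODr c x y : scaleO c (x + y) = scaleO c x + scaleO c y.
Proof. exact: scalerDr. Qed.

Lemma scaleODl c d x : scaleO (c + d) x = scaleO c x + scaleO d x.
Proof. by rewrite /scaleO order_scalarD scalerDl. Qed.

Lemma scaleO0 c : scaleO c 0 = 0.
Proof. exact: scaler0. Qed.

Lemma scaleON c x : scaleO c (- x) = - scaleO c x.
Proof. exact: scalerN. Qed.

Lemma scaleOZ c (a : order_ring A) x : scaleO c (a *: x) = a *: scaleO c x.
Proof. by rewrite /scaleO !scalerA order_scalarC. Qed.

End Modules.

Definition free_of_rank (R : pzRingType) (V : lmodType R) (d : nat) : Prop :=
  exists b : 'I_d -> V, forall v : V,
    exists! c : {ffun 'I_d -> R}, v = \sum_i c i *: b i.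

Definition internal_dsum (V : zmodType) (d : nat) (Y : set V)
    (N : 'I_d -> set V) : Prop :=
  (forall y, Y y <->
     exists2 v : 'I_d -> V, (forall i, N i (v i)) & y = \sum_i v i) /\
  (forall v : 'I_d -> V, (forall i, N i (v i)) -> \sum_i v i = 0 ->
     forall i, v i = 0).

Record mult_set (E : fieldExtType rat) := MultSet {
  mult_mem :> {pred ringInt E};
  mult_set1 : 1 \in mult_mem;
  mult_setM : {in mult_mem &, forall s t, s * t \in mult_mem};
  mult_set0 : 0 \notin mult_mem }.

Section Localization.
Variables (E : fieldExtType rat) (G : finGroupType) (A : int_order E G).
Variable S : mult_set E.
Local Notation EG := (grpalg E G).
Local Notation OE := (ringInt E).

(* [S^-1 A], realized inside [S^-1 E[G] = E[G]]. *)
Definition loc_mem : {pred EG} :=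
  fun a => `[< exists2 s : OE, s \in S & (s : E) *: a \in A >].

Lemma loc_memP (a : EG) :
  reflect (exists2 s : OE, s \in S & (s : E) *: a \in A) (a \in loc_mem).
Proof. by rewrite unfold_in; apply: asboolP. Qed.

Lemma loc_mem_closed : subring_closed loc_mem.
Proof.
split=> [|a b /loc_memP[s sS sa] /loc_memP[t tS tb]|
          a b /loc_memP[s sS sa] /loc_memP[t tS tb]]; apply/loc_memP.
- by exists 1; rewrite ?mult_set1 // scale1r rpred1.
- exists (s * t); first exact: mult_setM.
  rewrite scalerBr rpredB //=; last by rewrite -scalerA order_scale.
  by rewrite mulrC -scalerA order_scale.
- exists (s * t); first exact: mult_setM.
  by rewrite /= -scalerA scalerAr scalerAl rpredM.
Qed.

HB.instance Definition _ :=
  GRing.isSubringClosed.Build EG loc_mem loc_mem_closed.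

Record loc_ring := LocRing { loc_val :> EG; _ : loc_val \in loc_mem }.

HB.instance Definition _ := [isSub for loc_val].
HB.instance Definition _ := [Choice of loc_ring by <:].
HB.instance Definition _ := [SubChoice_isSubNzRing of loc_ring by <:].

Record denom := Denom { denom_val :> OE; denom_mem : denom_val \in S }.

HB.instance Definition _ := [isSub for denom_val].
HB.instance Definition _ := [Choice of denom by <:].

Definition denom1 : denom := Denom (mult_set1 S).
Definition denomM (s t : denom) : denom :=
  Denom (mult_setM (denom_mem s) (denom_mem t)).

Lemma loc_ring_numer (a : loc_ring) :
  exists p : order_ring A * denom, (p.2 : E) *: (a : EG) = p.1 :> EG.
Proof.
case: a => a /= /loc_memP[s sS sa]; by exists (OrderRing sa, Denom sS).
Qed.

Variable X : lmodType (order_ring A).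

(* [S^-1 X]: fractions [x / s], where [x / s = y / t] if and only if
   [u t x = u s y] for some [u] in [S]. *)
Definition frac_equiv (p q : X * denom) : bool :=
  `[< exists2 u : OE, u \in S &
        scaleO (u * q.2) p.1 = scaleO (u * p.2) q.1 >].

Lemma frac_equiv_class : equiv_class_of frac_equiv.
Proof.
split=> [[x s]|[x s] [y t]|[y t] [x s] [z r]].
- by apply/asboolP; exists 1; rewrite ?mult_set1.
- by apply/asboolP/asboolP => -[u uS e]; exists u.
- move=> /asboolP[u uS /= e] /asboolP[v vS /= f]; apply/asboolP.
  exists (u * v * t).
    by apply: mult_setM; [apply: mult_setM | apply: denom_mem].
  rewrite /= (_ : _ * (r : OE) = (v * (r : OE)) * (u * (t : OE))); last by ring.
  rewrite -(scaleOA (v * r)) e scaleOA mulrC -(scaleOA (u * s)) f scaleOA.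
  by congr (scaleO _ z); ring.
Qed.

Canonical frac_equiv_rel := EquivRelPack frac_equiv_class.
Canonical frac_encModRel := defaultEncModRel frac_equiv.

Definition loc_mod := {eq_quot frac_equiv}.

HB.instance Definition _ : EqQuotient _ frac_equiv loc_mod :=
  EqQuotient.on loc_mod.
HB.instance Definition _ := Choice.on loc_mod.

Definition frac (x : X) (s : denom) : loc_mod := \pi_loc_mod (x, s).

Lemma frac_eq x s y t : frac x s = frac y t <->
  exists2 u : OE, u \in S & scaleO (u * t) x = scaleO (u * s) y.
Proof.
rewrite /frac; split=> [/eqP|h]; first by rewrite piE => /asboolP.
by apply/eqP; rewrite piE; apply/asboolP.
Qed.

Lemma fracP (z : loc_mod) : exists x s, z = frac x s.
Proof.
by exists (repr z).1, (repr z).2; rewrite /frac -surjective_pairing reprK.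
Qed.

Definition loc_zero : loc_mod := frac 0 denom1.

Definition loc_opp (z : loc_mod) : loc_mod := frac (- (repr z).1) (repr z).2.

Definition loc_add (z w : loc_mod) : loc_mod :=
  frac (scaleO (repr w).2 (repr z).1 + scaleO (repr z).2 (repr w).1)
       (denomM (repr z).2 (repr w).2).

Definition loc_scale (a : loc_ring) (z : loc_mod) : loc_mod :=
  let p := projT1 (cid (loc_ring_numer a)) in
  frac (p.1 *: (repr z).1) (denomM p.2 (repr z).2).

Lemma frac_repr x s : frac (repr (frac x s)).1 (repr (frac x s)).2 = frac x s.
Proof. by rewrite {1}/frac -surjective_pairing reprK. Qed.

Lemma loc_oppE x s : loc_opp (frac x s) = frac (- x) s.
Proof.
have /frac_eq[u uS e] := frac_repr x s.
by apply/frac_eq; exists u => //; rewrite !scaleON e.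
Qed.

Lemma loc_addE x s y t : loc_add (frac x s) (frac y t) =
  frac (scaleO (t) x + scaleO (s) y) (denomM s t).
Proof.
rewrite /loc_add.
have /frac_eq[u uS] := frac_repr x s; have /frac_eq[v vS] := frac_repr y t.
move: (repr (frac x s)) (repr (frac y t)) => [x' s'] [y' t'] /= f e.
apply/frac_eq; exists (u * v); first exact: mult_setM.
rewrite !scaleODr !scaleOA /=; congr (_ + _).
- rewrite (_ : _ * (t' : OE) = v * t' * t * (u * s)); last by ring.
  by rewrite -(scaleOA _ (u * s)) e scaleOA; congr (scaleO _ x); ring.
- rewrite (_ : _ * (s' : OE) = u * s' * s * (v * t)); last by ring.
  by rewrite -(scaleOA _ (v * t)) f scaleOA; congr (scaleO _ y); ring.
Qed.

(* The action does not depend on the choice made in [loc_scale]. *)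
Lemma loc_scaleE (a : loc_ring) (s t : denom) (b : order_ring A) x :
  (s : E) *: (a : EG) = b :> EG ->
  loc_scale a (frac x t) = frac (b *: x) (denomM s t).
Proof.
rewrite /loc_scale; case: cid => -[b' s'] /= sab' sab.
have /frac_eq[u uS] := frac_repr x t.
move: (repr _) => [x' t'] /= e.
have sb : order_scalar A s * b' = order_scalar A s' * b.
  apply: val_inj; rewrite /= -!scalerAl !mul1r -sab' -sab !scalerA.
  by rewrite mulrC.
have sbx (y : X) : scaleO s (b' *: y) = scaleO s' (b *: y).
  by rewrite /scaleO !scalerA sb.
apply/frac_eq; exists u => //=.
rewrite (_ : u * _ = u * t * s); last by ring.
rewrite -(scaleOA (u * t)) sbx !scaleOZ; congr (b *: _).
rewrite e -/(scaleO _ _) scaleOA.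
by congr (scaleO _ _); ring.
Qed.

Lemma loc_addA : associative loc_add.
Proof.
move=> z w v; have [x [s ->]] := fracP z; have [y [t ->]] := fracP w.
have [x' [r ->]] := fracP v; rewrite !loc_addE; apply/frac_eq; exists 1.
  exact: mult_set1.
rewrite !scaleODr !scaleOA /= addrA.
by congr (scaleO _ _ + scaleO _ _ + scaleO _ _); ring.
Qed.

Lemma loc_addC : commutative loc_add.
Proof.
move=> z w; have [x [s ->]] := fracP z; have [y [t ->]] := fracP w.
rewrite !loc_addE; apply/frac_eq; exists 1; first exact: mult_set1.
by rewrite addrC; congr (scaleO _ _) => /=; ring.
Qed.

Lemma loc_add0 : left_id loc_zero loc_add.
Proof.
move=> z; have [x [s ->]] := fracP z; rewrite loc_addE.
apply/frac_eq; exists 1; first exact: mult_set1.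
by rewrite scaleO0 add0r scaleO1 /= !mul1r.
Qed.

Lemma loc_addN : left_inverse loc_zero loc_opp loc_add.
Proof.
move=> z; have [x [s ->]] := fracP z; rewrite loc_oppE loc_addE.
apply/frac_eq; exists 1; first exact: mult_set1.
by rewrite scaleON addNr !scaleO0.
Qed.

HB.instance Definition _ :=
  GRing.isZmodule.Build loc_mod loc_addA loc_addC loc_add0 loc_addN.

Lemma loc_scaleA a b z : loc_scale a (loc_scale b z) = loc_scale (a * b) z.
Proof.
have [x [r ->]] := fracP z.
have [[a' s] /= sa] := loc_ring_numer a; have [[b' t] /= tb] := loc_ring_numer b.
rewrite (loc_scaleE _ _ tb) (loc_scaleE _ _ sa).
rewrite (@loc_scaleE _ (denomM s t) _ (a' * b')) /=; last first.
  by rewrite -scalerA scalerAr tb scalerAl sa.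
rewrite scalerA; apply/frac_eq; exists 1; first exact: mult_set1.
by congr (scaleO _ _) => /=; ring.
Qed.

Lemma loc_scale1 : left_id 1 loc_scale.
Proof.
move=> z; have [x [r ->]] := fracP z.
rewrite (@loc_scaleE _ denom1 _ 1) /= ?scale1r //.
by apply/frac_eq; exists 1; rewrite ?mult_set1 //= !mul1r.
Qed.

Lemma loc_scaleDr : right_distributive loc_scale +%R.
Proof.
move=> a z w; have [x [s ->]] := fracP z; have [y [t ->]] := fracP w.
have [[a' r] /= ra] := loc_ring_numer a.
rewrite [_ + _]loc_addE !(loc_scaleE _ _ ra) [RHS]loc_addE.
apply/frac_eq; exists 1; first exact: mult_set1.
rewrite scalerDr !scaleODr -(scaleOZ t) -(scaleOZ s) !scaleOA /=.
by congr (scaleO _ _ + scaleO _ _); ring.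
Qed.

Lemma loc_scaleDl z : {morph loc_scale^~ z : a b / a + b}.
Proof.
move=> a b; have [x [r ->]] := fracP z.
have [[a' s] /= sa] := loc_ring_numer a; have [[b' t] /= tb] := loc_ring_numer b.
rewrite (loc_scaleE _ _ tb) (loc_scaleE _ _ sa) [RHS]loc_addE.
rewrite (@loc_scaleE _ (denomM s t) _
  (order_scalar A t * a' + order_scalar A s * b')) /=; last first.
  by rewrite -!scalerAl !mul1r -sa -tb scalerDr !scalerA; congr (_ *: _ + _);
    rewrite mulrC.
apply/frac_eq; exists 1; first exact: mult_set1.
rewrite scalerDl -!scalerA !scaleODr -/(scaleO t _) -/(scaleO s _) !scaleOA /=.
by congr (scaleO _ _ + scaleO _ _); ring.
Qed.

HB.instance Definition _ := GRing.Zmodule_isLmodule.Build loc_ring loc_mod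
  loc_scaleA loc_scale1 loc_scaleDr loc_scaleDl.

End Localization.

Section PrimeLocalization.
Variable E : fieldExtType rat.
Local Notation OE := (ringInt E).

Definition prime_compl_mem (P : prime_idealr OE) : {pred OE} :=
  fun s => s \notin P.

Lemma prime_compl1 P : 1 \in prime_compl_mem P.
Proof. by rewrite unfold_in idealr1. Qed.

Lemma prime_complM P :
  {in prime_compl_mem P &, forall s t, s * t \in prime_compl_mem P}.
Proof.
move=> s t sP tP; rewrite unfold_in prime_idealrM; apply/norP.
by split; [move: sP | move: tP]; rewrite unfold_in.
Qed.

Lemma prime_compl0 P : 0 \notin prime_compl_mem P.
Proof. by rewrite unfold_in negbK idealr0. Qed.

Definition prime_compl (P : prime_idealr OE) : mult_set E :=
  MultSet (prime_compl1 P) (@prime_complM P) (prime_compl0 P).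

Variables (G : finGroupType) (A : int_order E G) (X : lmodType (order_ring A)).

(* [loc_mod (prime_compl P) X] is a module over [loc_ring A (prime_compl P)],
   that is, [X_P] over [A_P]. *)
Definition locally_free (d : nat) : Prop :=
  forall P : prime_idealr OE, (exists2 x : OE, x \in P & x != 0) ->
    free_of_rank (loc_mod (prime_compl P) X) d.

End PrimeLocalization.

Section ScalarExtension.
Variable E : fieldExtType rat.
Local Notation OE := (ringInt E).

Definition nonzero_mem : {pred OE} := fun s => s != 0.

Lemma nonzero_memM : {in nonzero_mem &, forall s t, s * t \in nonzero_mem}.
Proof.
move=> s t; rewrite !unfold_in => s0 t0.
by rewrite -(inj_eq val_inj) /= mulf_neq0 // (inj_eq val_inj _ 0).
Qed.

Lemma nonzero_mem1 : 1 \in nonzero_mem.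
Proof. by rewrite unfold_in oner_neq0. Qed.

Lemma nonzero_mem0 : 0 \notin nonzero_mem.
Proof. by rewrite unfold_in eqxx. Qed.

Definition nonzero_set : mult_set E :=
  MultSet nonzero_mem1 nonzero_memM nonzero_mem0.

Variables (G : finGroupType) (A : int_order E G).
Local Notation EG := (grpalg E G).

Lemma loc_mem_nonzero (a : EG) : a \in loc_mem A nonzero_set.
Proof.
have [n [c [g [gA ->]]]] := order_full A a.
apply: rpred_sum => i _; have [s s0 sc] := integral_denom (c i).
apply/loc_memP; exists s; first by rewrite unfold_in.
by rewrite scalerA; apply: (order_scale (RingInt sc)).
Qed.

Definition to_loc (a : EG) : loc_ring A nonzero_set :=
  LocRing (loc_mem_nonzero a).

Variable X : lmodType (order_ring A).

(* [E (x) X], as the localization of [X] at the nonzero elements of [OE]; the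
   corresponding localization of [A] is all of [E[G]], since [A] has full rank. *)
Definition ext_mod := loc_mod nonzero_set X.

HB.instance Definition _ := GRing.Zmodule.on ext_mod.

Definition ext_scale (a : EG) (z : ext_mod) : ext_mod :=
  (to_loc a *: (z : loc_mod nonzero_set X)).

Lemma ext_scaleA a b z : ext_scale a (ext_scale b z) = ext_scale (a * b) z.
Proof. by rewrite /ext_scale scalerA; congr (_ *: _); apply: val_inj. Qed.

Lemma ext_scale1 : left_id 1 ext_scale.
Proof.
move=> z; rewrite /ext_scale (_ : to_loc 1 = 1) ?scale1r //.
exact: val_inj.
Qed.

Lemma ext_scaleDr : right_distributive ext_scale +%R.
Proof. by move=> a z w; rewrite /ext_scale scalerDr. Qed.

Lemma ext_scaleDl z : {morph ext_scale^~ z : a b / a + b}.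
Proof.
move=> a b; rewrite /ext_scale -scalerDl; congr (_ *: _); exact: val_inj.
Qed.

HB.instance Definition _ := GRing.Zmodule_isLmodule.Build EG ext_mod
  ext_scaleA ext_scale1 ext_scaleDr ext_scaleDl.

Definition ext_in (x : X) : ext_mod := frac x (denom1 nonzero_set).

(* [M X], the subgroup of [E (x) X] generated by the products [l x]. *)
Definition order_span (M : int_order E G) : set ext_mod :=
  [set z | exists (n : nat) (l : 'I_n -> EG) (x : 'I_n -> X),
     (forall i, l i \in M) /\ z = \sum_i l i *: ext_in (x i)]%classic.

End ScalarExtension.

Arguments order_span {E G A} X M.

Definition left_multiples (R : pzRingType) (V : lmodType R) (B : set R)
    (v : V) : set V :=
  [set b *: v | b in B]%classic.

(* Main.v *)
(* Let P be a nonzero prime and S its complement. Clearing denominators, S^-1 X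
   has a basis y_1, ..., y_d of elements of X. Write alpha = U y with entries of U
   in S^-1 A, and y = V alpha with entries of V in M, so that V U = 1. Matrices
   over M are integral over O_E; multiplying an integral equation of V by a power
   of U shows that V lies in O_E[U], hence that V has entries in S^-1 A and
   U V = 1. So alpha is a basis of S^-1 X. For x in X, the ideal of all s such
   that s x lies in the A-span of alpha is thus contained in no prime, i.e. it
   contains 1. The freeness of alpha needs one nonzero prime, which exists since
   2 is not a unit of O_E. *)
Require Import Defs.
From HB Require Import structures.
From mathcomp Require Import all_boot all_order all_fingroup all_algebra all_field.
From mathcomp Require Import ring_quotient boolp classical_sets.

Set Implicit Arguments.
Unset Strict Implicit.
Unset Printing Implicit Defensive.

Import GRing.Theory.
Local Open Scope ring_scope.
Local Open Scope classical_set_scope.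

(* [mathcomp.algebra.fraction] has a [frac] as well. *)
Local Notation frac := Defs.frac.

(** * General algebra: prime ideals, integrality and bases *)

(** Maximality among the ideals that contain [I] and avoid [1] forces primality: if [u] is not in
    [J], then [1 = j + a * u] with [j] in [J], so [v = j * v + a * (u * v)] lies in [J] as soon as
    [u * v] does. *)
Lemma prime_idealr_exists (R : comNzRingType) (I : set R) :
    I 0 -> ~ I 1 -> (forall x y, I x -> I y -> I (x + y)) ->
    (forall a x, I x -> I (a * x)) ->
  exists P : prime_idealr R, forall x, I x -> x \in P.
Proof.
move=> I0 I1 ID IM.
(* [Zorn_bigcup] also asks the property of the union of the empty chain, so it
   must hold of the empty set. *)
pose Q (J : set R) := [/\ ~ J 1, (forall x y, J x -> J y -> J (x + y)),
  (forall a x, J x -> J (a * x)) & (forall i x, I i -> J x -> J (i + x))].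
have [J [[J1 JD JM JI] Jmax]] : exists J, Q J /\ forall K, J `<` K -> ~ Q K.
  apply: Zorn_bigcup => F FQ Ftot; split.
  - by case=> J FJ J1; have [] := FQ J FJ.
  - move=> x y [J FJ Jx] [K FK Ky].
    have [JK|KJ] := Ftot J K FJ FK.
      by exists K => //; have [_ KD _ _] := FQ K FK; apply: KD => //; apply: JK.
    by exists J => //; have [_ JD _ _] := FQ J FJ; apply: JD => //; apply: KJ.
  - move=> a x [J FJ Jx]; exists J => //.
    by have [_ _ JM _] := FQ J FJ; apply: JM.
  - move=> i x Ii [J FJ Jx]; exists J => //.
    by have [_ _ _ JI] := FQ J FJ; apply: JI.
(* If [J] were empty, [I] would be a strictly larger set with property [Q]. *)
have J0 : J 0.
  have [[x Jx]|nJ] := pselect (exists x, J x).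
    by rewrite -(mul0r x); apply: JM.
  case: (Jmax I); last by split=> // i x; apply: ID.
  split=> [x Jx|]; first by case: nJ; exists x.
  by move=> /(_ 0 I0) J0; apply: nJ; exists 0.
have IJ x : I x -> J x by move=> Ix; rewrite -(addr0 x); apply: JI.
(* Otherwise the sum of [J] and the multiples of [x] would avoid [1] and contradict the maximality
   of [J]. *)
have Jadj x : ~ J x -> exists j a, J j /\ 1 = j + a * x.
  move=> nJx; apply: contrapT => nj.
  pose K := [set z | exists j a, J j /\ z = j + a * x].
  case: (Jmax K).
    split=> [z Jz|KJ]; first by exists z, 0; rewrite mul0r addr0.
    by apply/nJx/KJ; exists 0, 1; rewrite mul1r add0r.
  split=> //.
  - move=> _ _ [j [a [Jj ->]]] [k [b [Jk ->]]]; exists (j + k), (a + b).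
    by rewrite mulrDl addrACA; split=> //; apply: JD.
  - move=> c _ [j [a [Jj ->]]]; exists (c * j), (c * a).
    by rewrite mulrDr mulrA; split=> //; apply: JM.
  - move=> i _ Ii [j [a [Jj ->]]]; exists (i + j), a.
    by rewrite addrA; split=> //; apply: JI.
pose S : {pred R} := fun x => `[< J x >].
have SP x : reflect (J x) (x \in S) by rewrite unfold_in; apply: asboolP.
have Sideal : idealr_closed S.
  split; first exact/SP.
    by apply/SP.
  by move=> a u v /SP Ju /SP Jv; apply/SP/JD => //; apply: JM.
have Sprime : prime_idealr_closed S.
  move=> u v /SP Juv; apply/orP; have [Ju|nJu] := pselect (J u).
    by left; apply/SP.
  right; apply/SP; have [j [a [Jj e]]] := Jadj u nJu.
  rewrite -[v]mul1r e mulrDl -mulrA; apply: JD; last exact: JM.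
  by rewrite mulrC; apply: JM.
pose P : prime_idealr R := HB.pack (S : R -> bool)
  (isIdealr.Build R S Sideal) (isPrimeIdealrClosed.Build R S Sprime).
by exists P => x Ix; apply/SP/IJ.
Qed.

(* Cayley-Hamilton for the action of [V] on the generators [w] gives a monic
   relation [V ^+ N + ... + q 0 = 0]; multiplying it by [U ^+ N.-1] on the right
   solves it for [V]. *)
Lemma integral_left_inverse (k : comNzRingType) (B : nzRingType)
    (f : {rmorphism k -> B}) (N : nat) (w : 'I_N -> B) (C : 'M[k]_N)
    (r : 'I_N -> k) (V U : B) :
    (forall c b, f c * b = b * f c) ->
    (forall i, V * w i = \sum_j f (C i j) * w j) ->
    1 = \sum_i f (r i) * w i -> V * U = 1 ->
  exists n (q : 'I_n -> k), V = \sum_i f (q i) * U ^+ i.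
Proof.
case: N w C r => [|n] w C r fC VC r1 VU.
  by move/eqP: r1; rewrite big_ord0 oner_eq0.
have VCn i m : V ^+ m * w i = \sum_j f ((C ^+ m) i j) * w j.
  elim: m i => [|m IHm] i.
    rewrite mul1r (bigD1 i) //= mxE eqxx rmorph1 mul1r big1 ?addr0 // => j ji.
    by rewrite mxE eq_sym (negPf ji) rmorph0 mul0r.
  rewrite exprS -mulrA IHm mulr_sumr.
  under eq_bigr => j _ do rewrite mulrA -fC -mulrA VC mulr_sumr.
  rewrite exchange_big /=; apply: eq_bigr => l _.
  rewrite exprSr mxE rmorph_sum mulr_suml; apply: eq_bigr => j _.
  by rewrite mulrA rmorphM.
pose p := char_poly C.
have pC : \sum_(m < n.+2) p`_m *: C ^+ m = 0.
  rewrite -[RHS](Cayley_Hamilton C) /horner_mx /horner_morph.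
  rewrite (@horner_coef_wide _ n.+2); last first.
    by apply: leq_trans (size_poly _ _) _; rewrite size_char_poly.
  by apply: eq_bigr => m _; rewrite coef_map /= -mul_scalar_mx.
(* The polynomial [p] evaluated at [V] kills each [w i], hence also [1], their combination with
   coefficients [r]. *)
have pV : \sum_(m < n.+2) f p`_m * V ^+ m = 0.
  rewrite -[LHS]mulr1 r1 mulr_sumr big1 // => i _.
  rewrite mulrA -fC -mulrA mulr_suml.
  under eq_bigr => m _ do rewrite -mulrA VCn mulr_sumr.
  rewrite exchange_big /= big1 ?mulr0 // => j _.
  under eq_bigr => m _ do rewrite mulrA -rmorphM.
  rewrite -mulr_suml -rmorph_sum /=.
  have /matrixP/(_ i j) := pC; rewrite summxE mxE => e.
  rewrite (_ : \sum_(m < _) _ = 0) ?rmorph0 ?mul0r // -[RHS]e.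
  by apply: eq_bigr => m _; rewrite mxE.
(* Only [V * U = 1] is known, not [U * V = 1], so the powers are cancelled from the middle
   outwards. *)
have VUn m l : (m <= l)%N -> V ^+ m * U ^+ l = U ^+ (l - m).
  elim: m l => [|m IHm] [|l] // ml; first by rewrite mul1r subn0.
    by rewrite mul1r.
  by rewrite exprSr exprS mulrA -(mulrA _ V U) VU mulr1 IHm.
have pn : p`_n.+1 = 1.
  by have /monicP := char_poly_monic C; rewrite lead_coefE size_char_poly.
(* Multiplied by [U ^+ n], the leading term becomes [V] and the term of degree [m <= n] becomes a
   multiple of [U ^+ (n - m)], which explains the reversed index. *)
exists n.+1, (fun i => - p`_(n - i)).
have := congr1 ( *%R^~ (U ^+ n)) pV; rewrite /= mul0r mulr_suml big_ord_recr /=.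
rewrite pn rmorph1 mul1r exprS -mulrA VUn // subnn mulr1 addrC => /eqP.
rewrite addr_eq0 -sumrN => /eqP ->.
rewrite (reindex_inj rev_ord_inj) /=; apply: eq_bigr => i _.
rewrite subSS -mulrA VUn ?leq_subr // subKn -1?ltnS //.
by rewrite rmorphN mulNr.
Qed.

(** Trades the unique existence of coordinates for spanning and independence, the form used
    throughout; uniqueness is independence applied to a difference. *)
Lemma free_of_rankP (R : pzRingType) (V : lmodType R) (d : nat) :
  free_of_rank V d <-> exists b : 'I_d -> V,
    (forall v, exists c : 'I_d -> R, v = \sum_i c i *: b i) /\
    (forall c : 'I_d -> R, \sum_i c i *: b i = 0 -> forall i, c i = 0).
Proof.
split=> -[b]; last first.
  case=> bspan bfree; exists b => v; have [c vc] := bspan v.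
  exists [ffun i => c i]; split.
    by rewrite vc; apply: eq_bigr => i _; rewrite ffunE.
  move=> c' vc'; apply/ffunP => i; rewrite ffunE; apply/subr0_eq.
  apply: (bfree (fun i => c i - c' i)).
  under eq_bigr do rewrite scalerBl.
  by rewrite sumrB -vc -vc' subrr.
move=> bP; exists b; split=> [v|c c0 i]; first by have [c []] := bP v; exists c.
have [c0' [_ cU]] := bP 0.
have Ec : c0' = [ffun=> 0].
  by apply: cU; rewrite big1 // => j _; rewrite ffunE scale0r.
have : c0' = [ffun j => c j].
  by apply: cU; rewrite -[LHS]c0; apply: eq_bigr => j _; rewrite ffunE.
by rewrite Ec => /ffunP/(_ i); rewrite !ffunE.
Qed.

(** * Fractions with denominators in [S] *)

Section Fractions.
Variables (E : fieldExtType rat) (G : finGroupType) (A : int_order E G).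
Variables (S : mult_set E).
Local Notation EG := (grpalg E G).
Local Notation OE := (ringInt E).

Lemma ringInt_eq0 (s : OE) : ((s : E) == 0) = (s == 0).
Proof. exact: (inj_eq val_inj s 0). Qed.

Lemma mult_set_neq0 (s : OE) : s \in S -> (s : E) != 0.
Proof.
by move=> sS; rewrite ringInt_eq0; apply: contraTneq sS => ->; apply: mult_set0.
Qed.

(** The product of the individual denominators works, since [A] is stable under scaling by [OE]. *)
Lemma loc_common_denom (T : finType) (c : T -> EG) :
    (forall t, c t \in loc_mem A S) ->
  exists2 s : OE, s \in S & forall t, (s : E) *: c t \in A.
Proof.
move=> cl.
have /choice[s sP] : forall t, exists s : OE, s \in S /\ (s : E) *: c t \in A.
  by move=> t; have /loc_memP[s sS sc] := cl t; exists s.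
exists (\prod_t s t).
  elim/big_ind: _ => [||t _]; [exact: mult_set1|exact: mult_setM|].
  by have [] := sP t.
move=> t; rewrite (bigD1 t) //= mulrC -scalerA; apply: order_scale.
by have [] := sP t.
Qed.

Variable X : lmodType (order_ring A).
Local Notation XS := (loc_mod S X).

Lemma frac0 (s : denom S) : frac 0 s = 0 :> XS.
Proof. by apply/frac_eq; exists 1; rewrite ?mult_set1 // !scaleO0. Qed.

Lemma fracD (x y : X) (s : denom S) : frac (x + y) s = frac x s + frac y s.
Proof.
rewrite [RHS]loc_addE -scaleODr; apply/frac_eq.
exists 1; first exact: mult_set1.
by rewrite !mul1r scaleOA.
Qed.

Lemma frac_sum (n : nat) (x : 'I_n -> X) (s : denom S) :
  \sum_i frac (x i) s = frac (\sum_i x i) s.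
Proof.
apply/esym/(big_morph (fun z => frac z s)) => [y z|]; first exact: fracD.
exact: frac0.
Qed.

(** The factor [u] in the equality of fractions is nonzero, as [0] is not in [S], so
    torsion-freeness cancels it. *)
Lemma frac_inj (hX : torsion_free X) (x y : X) (s t : denom S) :
  frac x s = frac y t -> scaleO t x = scaleO s y.
Proof.
case/frac_eq => u /mult_set_neq0 u0 e; apply/subr0_eq.
have : scaleO u (scaleO t x - scaleO s y) = 0.
  by rewrite scaleODr scaleON !scaleOA e subrr.
by case/hX => // u0'; rewrite u0' eqxx in u0.
Qed.

(** Clears the denominators of a linear relation over [loc_ring A S], to reduce it to one over
    [A]. *)
Lemma frac_lincomb (n : nat) (c : 'I_n -> loc_ring A S) :
  exists (s : denom S) (a : 'I_n -> order_ring A),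
    (forall i, (s : E) *: (c i : EG) = a i :> EG) /\
    (forall x : 'I_n -> X,
       \sum_i c i *: frac (x i) (denom1 S) = frac (\sum_i a i *: x i) s).
Proof.
have [|s sS sc] := @loc_common_denom _ (fun i => c i : EG).
  by move=> i; apply: valP.
exists (Denom sS), (fun i => OrderRing (sc i)); split=> // x.
rewrite -frac_sum; apply: eq_bigr => i _.
rewrite [LHS](@loc_scaleE _ _ _ _ _ (c i) (Denom sS) _ (OrderRing (sc i))) //.
by apply/frac_eq; exists 1; rewrite ?mult_set1 //= mulr1.
Qed.

Lemma loc_mem_scalar (s : denom S) : (s : E)%:A \in loc_mem A S.
Proof.
apply/loc_memP; exists 1; rewrite ?mult_set1 // scale1r.
exact: (valP (order_scalar A s)).
Qed.

Lemma loc_mem_scalarV (s : denom S) : (s : E)^-1%:A \in loc_mem A S.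
Proof.
apply/loc_memP; exists (s : OE); first exact: denom_mem.
by rewrite scalerA mulfV ?mult_set_neq0 ?denom_mem // scale1r rpred1.
Qed.

(* The denominators of a basis are units of [loc_ring A S], so they can be
   removed. *)
Lemma free_loc_basis (d : nat) : torsion_free X -> free_of_rank XS d ->
  exists y : 'I_d -> X,
    (forall x, exists (s : denom S) (a : 'I_d -> order_ring A),
       scaleO s x = \sum_i a i *: y i) /\
    (forall a : 'I_d -> order_ring A,
       \sum_i a i *: y i = 0 -> forall i, a i = 0).
Proof.
move=> hX /free_of_rankP[b [bspan bfree]].
have /choice[ys ysP] : forall i, exists ys : X * denom S, b i = frac ys.1 ys.2.
  by move=> i; have [x [s ->]] := fracP (b i); exists (x, s).
pose s i := (ys i).2; pose y i := (ys i).1.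
have s0 i : (s i : E) != 0 by rewrite mult_set_neq0 ?denom_mem.
pose u i : loc_ring A S := LocRing (loc_mem_scalar (s i)).
pose u' i : loc_ring A S := LocRing (loc_mem_scalarV (s i)).
have uu' i : u i * u' i = 1.
  by apply: val_inj; rewrite /= -scalerAl mul1r scalerA mulfV // scale1r.
have ub i : u i *: b i = frac (y i) (denom1 S).
  pose si := order_scalar A (s i).
  rewrite ysP [LHS](@loc_scaleE _ _ _ _ _ _ (denom1 S) _ si);
    last by rewrite /= scale1r.
  apply/frac_eq; exists 1; rewrite ?mult_set1 //= !mul1r -/(scaleO _ _).
  by rewrite scaleO1.
have bE i : b i = u' i *: frac (y i) (denom1 S).
  rewrite -ub scalerA (_ : u' i * u i = 1) ?scale1r //.
  by apply: val_inj; rewrite /= -scalerAl mul1r scalerA mulVf // scale1r.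
exists y; split=> [x|a a0 i].
  have [c xc] := bspan (frac x (denom1 S)).
  (* Each [b i] is [u' i] times the fraction [y i / 1], so these are the coordinates with respect to
     the [y i / 1]. *)
  have [t [a [_ ta]]] := frac_lincomb (fun i => c i * u' i).
  exists t, a; rewrite -[RHS]scaleO1.
  apply: (frac_inj hX (s := denom1 S)); rewrite xc -ta.
  by apply: eq_bigr => i _; rewrite bE scalerA.
have al j : (a j : EG) \in loc_mem A S.
  by apply/loc_memP; exists 1; rewrite ?mult_set1 // scale1r; apply: valP.
(* As [u j *: b j] is [y j / 1], the relation [a0] becomes one between the [b j]; the unit [u i] is
   cancelled afterwards. *)
have : \sum_j (LocRing (al j) * u j) *: b j = 0.
  rewrite -[RHS](frac0 (denom1 S)) -a0 -frac_sum; apply: eq_bigr => j _.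
  rewrite -scalerA ub [LHS](@loc_scaleE _ _ _ _ _ _ (denom1 S) _ (a j)) /=.
    by apply/frac_eq; exists 1; rewrite ?mult_set1 //= !mul1r.
  by rewrite scale1r.
move/bfree/(_ i)/(congr1 ( *%R^~ (u' i))); rewrite -mulrA uu' mulr1 mul0r.
by move/(congr1 val) => /= ai; apply: val_inj.
Qed.

(** A basis of [X] stays one when viewed as fractions over [1]: coordinates are divided by the
    denominator, and relations are cleared of theirs. *)
Lemma free_localization (d : nat) : torsion_free X ->
  free_of_rank X d -> free_of_rank XS d.
Proof.
move=> hX /free_of_rankP[b [bspan bfree]]; apply/free_of_rankP.
exists (fun i => frac (b i) (denom1 S)); split=> [z|c c0 i].
  have [x [s ->]] := fracP z; have [a ->] := bspan x.
  have al i : (s : E)^-1 *: (a i : EG) \in loc_mem A S.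
    apply/loc_memP; exists (s : OE); first exact: denom_mem.
    by rewrite scalerA mulfV ?mult_set_neq0 ?denom_mem // scale1r; apply: valP.
  exists (fun i => LocRing (al i)); rewrite -frac_sum; apply: eq_bigr => i _.
  rewrite [RHS](@loc_scaleE _ _ _ _ _ _ s _ (a i)) /=.
    by apply/frac_eq; exists 1; rewrite ?mult_set1 //= mulr1.
  by rewrite scalerA mulfV ?scale1r // mult_set_neq0 ?denom_mem.
have [s [a [sa /(_ b)]]] := frac_lincomb c; rewrite c0 -(frac0 s).
move/esym/(frac_inj hX); rewrite scaleO0 /scaleO scaler_sumr.
under eq_bigr do rewrite scalerA.
move/bfree/(_ i)/(congr1 val) => /=.
rewrite -scalerAl mul1r -sa scalerA => /eqP.
(* The coefficient is [s * s] times [c i]: one factor comes from clearing [c], the other from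
   comparing two fractions over [s]. *)
rewrite scaler_eq0 mulf_eq0 orbb (negPf (mult_set_neq0 (denom_mem s))) /=.
by move/eqP => ci; apply: val_inj.
Qed.

End Fractions.

(** * The embedding of [X] into its extension of scalars *)

Section Extension.
Variables (E : fieldExtType rat) (G : finGroupType) (A : int_order E G).
Variable X : lmodType (order_ring A).
Hypothesis hX : torsion_free X.
Local Notation EG := (grpalg E G).
Local Notation OE := (ringInt E).

Lemma ext_inZ (a : order_ring A) (x : X) :
  ext_in (a *: x) = (a : EG) *: ext_in x.
Proof.
apply/esym; rewrite [LHS](@loc_scaleE _ _ _ _ _ _ (denom1 _) _ a) /=.
  by apply/frac_eq; exists 1; rewrite ?mult_set1 //= !mul1r.
by rewrite scale1r.
Qed.

Lemma ext_in_lincomb (n : nat) (a : 'I_n -> order_ring A) (x : 'I_n -> X) :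
  ext_in (\sum_i a i *: x i) = \sum_i (a i : EG) *: ext_in (x i).
Proof.
rewrite [LHS](esym (frac_sum _ _)).
by apply: eq_bigr => i _; rewrite -ext_inZ.
Qed.

Lemma ext_in_scaleO (s : OE) (x : X) :
  ext_in (scaleO s x) = (s : E)%:A *: ext_in x.
Proof. exact: ext_inZ. Qed.

Lemma ext_in_inj : injective (@ext_in E G A X).
Proof. by move=> x y /(frac_inj hX); rewrite !scaleO1. Qed.

Lemma ext_in0 : ext_in (0 : X) = 0.
Proof. exact: frac0. Qed.

(** A relation over [E[G]] becomes one over [A] after multiplication by a nonzero element of [OE].
    This makes it possible to compare coefficient matrices over [E[G]]. *)
Lemma ext_in_free (n : nat) (y : 'I_n -> X) :
    (forall a : 'I_n -> order_ring A,
       \sum_i a i *: y i = 0 -> forall i, a i = 0) ->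
  forall r : 'I_n -> EG, \sum_i r i *: ext_in (y i) = 0 -> forall i, r i = 0.
Proof.
move=> yfree r r0 i.
have [s [a [sa /(_ y)]]] := frac_lincomb X (fun i => to_loc A (r i)).
rewrite [X in X = _ -> _]r0 -(frac0 X s) => /esym/(frac_inj hX).
rewrite scaleO0 /scaleO scaler_sumr; under eq_bigr do rewrite scalerA.
move/yfree/(_ i)/(congr1 val) => /=.
rewrite -scalerAl mul1r -sa scalerA => /eqP.
rewrite scaler_eq0 mulf_eq0 orbb (negPf (mult_set_neq0 (denom_mem s))) /=.
by move/eqP.
Qed.

End Extension.

(** * Integrality of matrices over an order *)

Section MatrixOrder.
Variables (E : fieldExtType rat) (G : finGroupType) (M : int_order E G).
Variable d : nat.
Local Notation EG := (grpalg E G).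
Local Notation OE := (ringInt E).
Local Notation Mat := 'M[EG]_d.+1.

(** These scalar matrices are central although [E[G]] need not be commutative. The size [d.+1]
    ensures that the matrices form a nonzero ring. *)
Definition scalar_mxO : {rmorphism OE -> Mat} :=
  (@scalar_mx EG d.+1 \o (in_alg EG \o (val : OE -> E))).

Lemma scalar_mxOE c i j (B : Mat) : (scalar_mxO c * B) i j = (c : E) *: B i j.
Proof. by rewrite [_ * _]mul_scalar_mx mxE -scalerAl mul1r. Qed.

Lemma scalar_mxOC c (B : Mat) : scalar_mxO c * B = B * scalar_mxO c.
Proof.
apply/matrixP => i j; rewrite scalar_mxOE mxE (bigD1 j) //= mxE eqxx.
rewrite -scalerAr mulr1 big1 ?addr0 // => l lj.
by rewrite mxE (negPf lj) mulr0.
Qed.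

(* The elements [g_k e_(i,j)] generate the matrices over [M] when the [g_k]
   generate [M]. *)
Lemma mxOver_order_fg : exists (N : nat) (w : 'I_N -> Mat),
  (forall t, w t \is a mxOver M) /\
  (forall B, B \is a mxOver M ->
     exists c : 'I_N -> OE, B = \sum_t scalar_mxO (c t) * w t).
Proof.
have [n [g [gM gspan]]] := order_fg M.
pose T := ('I_d.+1 * 'I_d.+1 * 'I_n)%type.
pose w (t : T) : Mat := g t.2 *: delta_mx t.1.1 t.1.2.
exists #|{: T}|, (fun t => w (enum_val t)); split=> [t|B /mxOverP BM].
  apply/mxOverP => i j; rewrite !mxE; apply: rpredM; first exact: gM.
  exact: rpred_nat.
have /choice[c cP] : forall ij, exists c : 'I_n -> OE,
    B ij.1 ij.2 = \sum_k (c k : E) *: g k.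
  by move=> ij; apply: gspan.
exists (fun t => let u := enum_val t in c u.1 u.2).
rewrite -(big_enum_val (A := {: T}) (fun t => scalar_mxO (c t.1 t.2) * w t)) /=.
transitivity (\sum_ij \sum_k scalar_mxO (c ij k) * w (ij, k)); last first.
  by rewrite pair_bigA; apply: eq_bigr => -[].
rewrite [LHS]matrix_sum_delta pair_bigA /=; apply: eq_bigr => -[i j] _.
rewrite (cP (i, j)) scaler_suml; apply: eq_bigr => k _.
by apply/matrixP => i' j'; rewrite scalar_mxOE !mxE scalerAl.
Qed.

(** The matrices over [M] form a finitely generated [OE]-module that contains [1] and is stable
    under left multiplication by [V], which is what the Cayley-Hamilton argument needs. *)
Lemma order_mx_left_inverse (V U : Mat) : V \is a mxOver M -> V * U = 1 ->
  exists n (q : 'I_n -> OE), V = \sum_i scalar_mxO (q i) * U ^+ i.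
Proof.
move=> VM; have [N [w [wM wspan]]] := mxOver_order_fg.
have /choice[C CP] : forall t, exists c : 'I_N -> OE,
    V * w t = \sum_u scalar_mxO (c u) * w u.
  by move=> t; apply: wspan; apply: rpredM.
have [r r1] : exists r : 'I_N -> OE, 1 = \sum_t scalar_mxO (r t) * w t.
  by apply: wspan; apply: rpred1.
apply: (integral_left_inverse (C := \matrix_(t, u) C t u) scalar_mxOC _ r1).
by move=> t; rewrite CP; apply: eq_bigr => u _; rewrite mxE.
Qed.

End MatrixOrder.

(** * A proper nonzero ideal of the ring of integers *)

(** One half is not integral: a monic integral equation of degree [n] for it, multiplied by [2 ^ n],
    would make an odd integer vanish. *)
Lemma two_not_unit (E : fieldExtType rat) (y : ringInt E) : y * 2%:R <> 1.
Proof.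
move=> y2; have /integral_eltP[p p1 /eqP] := valP y.
rewrite horner_coef.
have [n sp] : exists n, size p = n.+1.
  by case: (size p) (size_poly_eq0 p) (monic_neq0 p1) => [<-//|n]; exists n.
have pn : p`_n = 1 by move/monicP: p1; rewrite lead_coefE sp.
have -> : size (map_poly (intr : int -> E) p) = n.+1.
  by rewrite size_map_poly_id0 // intr_fieldExt_eq0 lead_coef_eq0 monic_neq0.
rewrite big_ord_recr /= coef_map /= pn => /(congr1 ( *%R (2%:R ^+ n))).
have y2n i : (i <= n)%N -> (2%:R ^+ n : E) * (y : E) ^+ i = 2%:R ^+ (n - i).
  move=> le_in; rewrite -{1}(subnK le_in) exprD -mulrA -exprMn mulrC.
  by have := congr1 val y2; rewrite /= mulrC => ->; rewrite expr1n mul1r.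
rewrite mulr0 mulrDr mulr_sumr mul1r y2n // subnn expr0 => e.
(* Half the sum of the lower terms; each of them keeps a factor [2] because [i < n]. *)
pose z : int := \sum_(i < n) p`_i * 2%:R ^+ (n - i.+1).
have : (z * 2%:R + 1)%:~R = 0 :> E.
  rewrite -[RHS]e rmorphD rmorph1 mulr_suml rmorph_sum; congr (_ + _).
  apply: eq_bigr => i _; rewrite -mulrA -exprSr subnSK //.
  by rewrite coef_map mulrCA y2n 1?ltnW // rmorphM rmorphXn.
by move/eqP; rewrite intr_fieldExt_eq0 => /eqP/(congr1 (modz^~ 2));
  rewrite modzMDl.
Qed.

(** * Comparison of bases over one localization *)

Section Local.
Variables (E : fieldExtType rat) (G : finGroupType) (A M : int_order E G).
Variables (S : mult_set E) (X : lmodType (order_ring A)) (d : nat).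
Variable alpha : 'I_d.+1 -> X.
Local Notation EG := (grpalg E G).
Local Notation Mat := 'M[EG]_d.+1.
Hypothesis hX : torsion_free X.
Hypothesis alpha_span : forall x : X, exists m : 'I_d.+1 -> EG,
  (forall i, m i \in M) /\ ext_in x = \sum_i m i *: ext_in (alpha i).
Hypothesis hS : free_of_rank (loc_mod S X) d.+1.

(** The transition matrices [U] and [V] turn out to be mutually inverse over [loc_mem A S], so
    spanning and independence pass from the basis [y] to [alpha]. *)
Lemma loc_free_basis :
  (forall x, exists2 s, s \in S &
     exists a : 'I_d.+1 -> order_ring A, scaleO s x = \sum_i a i *: alpha i) /\
  (forall a : 'I_d.+1 -> order_ring A,
     \sum_i a i *: alpha i = 0 -> forall i, a i = 0).
Proof.
have [y [yspan yfree]] := free_loc_basis hX hS.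
have yfreeE := ext_in_free hX yfree.
have yspanE x : exists u : 'I_d.+1 -> EG, (forall i, u i \in loc_mem A S) /\
    ext_in x = \sum_i u i *: ext_in (y i).
  have [s [a sx]] := yspan x; have s0 := mult_set_neq0 (denom_mem s).
  exists (fun i => (s : E)^-1%:A * (a i : EG)); split=> [i|].
    apply: rpredM; first exact: loc_mem_scalarV.
    by apply/loc_memP; exists 1; rewrite ?mult_set1 // scale1r; apply: valP.
  under eq_bigr do rewrite -scalerA.
  rewrite -scaler_sumr -ext_in_lincomb -sx ext_in_scaleO scalerA.
  by rewrite -scalerAl mul1r scalerA mulVf // !scale1r.
have /choice[u uP] := fun i => yspanE (alpha i).
have /choice[v vP] := fun i => alpha_span (y i).
pose U : Mat := \matrix_(i, j) u i j; pose V : Mat := \matrix_(i, j) v i j.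
have alphaE i : ext_in (alpha i) = \sum_j U i j *: ext_in (y j).
  by have [_ ->] := uP i; apply: eq_bigr => j _; rewrite mxE.
have yE i : ext_in (y i) = \sum_j V i j *: ext_in (alpha j).
  by have [_ ->] := vP i; apply: eq_bigr => j _; rewrite mxE.
(* Coefficients act on the left, hence form rows, and a change of vectors multiplies these by [B] on
   the right. *)
have lincomb_subst (r : 'I_d.+1 -> EG) (B : Mat) (z z' : 'I_d.+1 -> X) :
    (forall i, ext_in (z i) = \sum_j B i j *: ext_in (z' j)) ->
    \sum_i r i *: ext_in (z i) =
      \sum_j (\sum_i r i * B i j) *: ext_in (z' j).
  move=> zE; under eq_bigr => i _.
    rewrite zE scaler_sumr; under eq_bigr do rewrite scalerA; over.
  by rewrite exchange_big; apply: eq_bigr => j _; rewrite scaler_suml.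
(* Expressing [y] by [alpha] and then [alpha] by [y] gives [y = V U y], and the [y i] are
   independent over [E[G]]. *)
have VU : V * U = 1.
  apply/matrixP => i j; apply/subr0_eq.
  apply: (yfreeE (fun l => (V * U) i l - (1 : Mat) i l)).
  under eq_bigr do rewrite scalerBl.
  rewrite sumrB; apply/eqP; rewrite subr_eq0; apply/eqP.
  under eq_bigr do rewrite mxE.
  rewrite -(lincomb_subst _ _ _ _ alphaE) -yE (bigD1 i) //= mxE eqxx scale1r.
  by rewrite big1 ?addr0 // => l li; rewrite mxE eq_sym (negPf li) scale0r.
have VM : V \is a mxOver M.
  by apply/mxOverP => i j; rewrite mxE; have [] := vP i.
have US : U \is a mxOver (loc_mem A S).
  by apply/mxOverP => i j; rewrite mxE; have [] := uP i.
have [n [q Vq]] := order_mx_left_inverse VM VU.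
have VS : V \is a mxOver (loc_mem A S).
  rewrite Vq; apply: rpred_sum => i _; apply: rpredM; last exact: rpredX.
  apply: mxOver_scalar; first exact: rpred0.
  apply/loc_memP; exists 1; rewrite ?mult_set1 // scale1r.
  exact: (valP (order_scalar A (q i))).
(* As a polynomial in [U] with central coefficients, [V] commutes with [U]. *)
have UV : U * V = 1.
  rewrite -VU Vq mulr_suml mulr_sumr; apply: eq_bigr => i _.
  by rewrite mulrA -scalar_mxOC -!mulrA -exprS -exprSr.
split=> [x|a].
  have [r [rS xr]] := yspanE x.
  rewrite (lincomb_subst _ _ _ _ yE) in xr.
  have [j|s sS sr] := @loc_common_denom E G A S _ (fun j => \sum_i r i * V i j).
    by apply: rpred_sum => i _; apply: rpredM => //; apply/mxOverP.
  exists s => //; exists (fun j => OrderRing (sr j)); apply: (ext_in_inj hX).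
  rewrite ext_in_lincomb ext_in_scaleO xr scaler_sumr.
  by apply: eq_bigr => j _; rewrite scalerA -scalerAl mul1r.
move=> a0 i; apply: val_inj => /=.
have : ext_in (\sum_i a i *: alpha i) = 0 by rewrite a0 ext_in0.
rewrite ext_in_lincomb (lincomb_subst _ _ _ _ alphaE) => /yfreeE aU.
(* Independence of the [y j] gives [a' U = 0], and [V] then cancels [U] on the right. *)
pose a' : 'rV[EG]_d.+1 := \row_l (a l : EG).
have : a' *m U = 0.
  apply/rowP => j; rewrite !mxE -[RHS](aU j).
  by apply: eq_bigr => l _; rewrite mxE.
move/(congr1 (mulmx^~ V)); rewrite -mulmxA [U *m V]UV mulmx1 mul0mx.
by move/rowP/(_ i); rewrite !mxE.
Qed.

End Local.

(** * From the localizations to [X], and the equivalence *)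

(** Shows that the given [alpha] is itself a basis, which serves both the converse implication and
    the final claim. *)
Lemma locally_free_basis (E : fieldExtType rat) (G : finGroupType)
    (A M : int_order E G) (X : lmodType (order_ring A)) (d : nat)
    (alpha : 'I_d.+1 -> X) :
    torsion_free X ->
    (forall x : X, exists m : 'I_d.+1 -> grpalg E G,
       (forall i, m i \in M) /\ ext_in x = \sum_i m i *: ext_in (alpha i)) ->
    locally_free X d.+1 ->
  (forall x, exists a : 'I_d.+1 -> order_ring A, x = \sum_i a i *: alpha i) /\
  (forall a : 'I_d.+1 -> order_ring A,
     \sum_i a i *: alpha i = 0 -> forall i, a i = 0).
Proof.
move=> hX alpha_span hloc.
have locP P hP := loc_free_basis hX alpha_span (hloc P hP).
(* Local freeness speaks of nonzero primes only; the nonzero element [c] of [I] guarantees that the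
   prime found is one. *)
have exP (I : set (ringInt E)) c : I 0 -> ~ I 1 -> I c -> c != 0 ->
    (forall x y, I x -> I y -> I (x + y)) -> (forall a x, I x -> I (a * x)) ->
  exists2 P : prime_idealr (ringInt E), (exists2 c, c \in P & c != 0) &
    forall x, I x -> x \in P.
  move=> I0 I1 Ic c0 ID IM; have [P IP] := prime_idealr_exists I0 I1 ID IM.
  by exists P => //; exists c => //; apply: IP.
split=> [x|]; last first.
  have [||||||P hP _] := exP [set z | exists y, z = y * 2%:R] 2%:R.
  - by exists 0; rewrite mul0r.
  - by case=> y /esym/two_not_unit.
  - by exists 1; rewrite mul1r.
  - apply/eqP => two0; have /eqP : 2%:Z%:~R = 0 :> E := congr1 val two0.
    by rewrite intr_fieldExt_eq0.
  - by move=> _ _ [y ->] [z ->]; exists (y + z); rewrite mulrDl.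
  - by move=> a _ [y ->]; exists (a * y); rewrite mulrA.
  by have [_] := locP P hP.
pose I := [set s | exists a : 'I_d.+1 -> order_ring A,
                     scaleO s x = \sum_i a i *: alpha i].
suff [a xa] : I 1 by exists a; rewrite -xa scaleO1.
apply: contrapT => I1.
have I0 : I 0.
  exists (fun=> 0); rewrite big1 => [|i _]; last exact: scale0r.
  rewrite /scaleO (_ : order_scalar A 0 = 0) ?scale0r //.
  by apply: val_inj; rewrite /= scale0r.
(* A nonzero element of [I] is a common denominator of the coordinates of [x], which a priori lie
   only in [E[G]]. *)
have [m [_ xm]] := alpha_span x.
have [s s0 sm] :=
  @loc_common_denom E G A _ _ m (fun i => loc_mem_nonzero A (m i)).
have Is : I s.
  exists (fun i => OrderRing (sm i)); apply: (ext_in_inj hX).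
  rewrite ext_in_scaleO ext_in_lincomb xm scaler_sumr.
  by apply: eq_bigr => i _; rewrite scalerA -scalerAl mul1r.
have [|y z [a ya] [b zb]|b y [a ya]|P hP IP] := exP I s I0 I1 Is.
- by rewrite unfold_in in s0.
- exists (fun i => a i + b i); rewrite scaleODl ya zb -big_split /=.
  by apply: eq_bigr => i _; rewrite scalerDl.
- exists (fun i => order_scalar A b * a i); rewrite -scaleOA ya.
  by rewrite /scaleO scaler_sumr; apply: eq_bigr => i _; rewrite scalerA.
have [/(_ x)[t tP [a ta]] _] := locP P hP.
by have := IP t (ex_intro _ a ta); rewrite (negPf tP).
Qed.

Theorem proposition2p1 (E : fieldExtType rat) (G : finGroupType)
    (A M : int_order E G) (hM : maximal_order M) (hAM : {subset A <= M})
    (X : lmodType (order_ring A)) (hX : lattice X)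
    (d : nat) (hd : (0 < d)%N) :
  (free_of_rank X d <->
     (locally_free X d /\
      exists alpha : 'I_d -> X,
        internal_dsum (order_span X M)
          (fun i => left_multiples [set` M] (ext_in (alpha i))))) /\
  (forall alpha : 'I_d -> X,
     locally_free X d ->
     internal_dsum (order_span X M)
       (fun i => left_multiples [set` M] (ext_in (alpha i))) ->
     internal_dsum [set: X]
       (fun i => left_multiples [set: order_ring A] (alpha i))).
Proof.
have {hX} tX : torsion_free X by case: hX.
have basis (alpha : 'I_d -> X) : locally_free X d ->
    internal_dsum (order_span X M)
      (fun i => left_multiples [set` M] (ext_in (alpha i))) ->
  (forall x, exists a : 'I_d -> order_ring A, x = \sum_i a i *: alpha i) /\
  (forall a : 'I_d -> order_ring A,
     \sum_i a i *: alpha i = 0 -> forall i, a i = 0).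
  case: d hd alpha => // d' _ alpha hloc [spanM _].
  apply: (@locally_free_basis _ _ _ M) => // x.
  have : order_span X M (ext_in x).
    exists 1%N, (fun=> 1), (fun=> x); split=> [i|]; first exact: rpred1.
    by rewrite big_ord1 scale1r.
  case/spanM => v vM xv.
  have /choice[m mP] :
      forall i, exists m, m \in M /\ m *: ext_in (alpha i) = v i.
    by move=> i; have [m mM mv] := vM i; exists m.
  exists m; split=> [i|]; first by have [] := mP i.
  by rewrite xv; apply: eq_bigr => i _; have [] := mP i.
split=> [|alpha hloc hdsum].
  split=> [Xfree|[hloc [alpha hdsum]]]; last first.
    by apply/free_of_rankP; exists alpha; apply: basis.
  split; first by move=> P _; apply: free_localization.
  (* Independence is taken over all of [E[G]], so that it gives directness of the sum over [M]. *)
  have /free_of_rankP[alpha [aspan /(ext_in_free tX) afree]] := Xfree.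
  exists alpha; split=> [z|v vM]; last first.
    have /choice[m mv] : forall i, exists m, m *: ext_in (alpha i) = v i.
      by move=> i; have [m _ mv] := vM i; exists m.
    under eq_bigr do rewrite -mv.
    by move=> /afree m0 i; rewrite -mv m0 scale0r.
  split=> [[n [l [x [lM ->]]]]|[v vM ->]].
    have /choice[a xa] := fun i => aspan (x i).
    (* Expanding the [x i] on [alpha] gives products of elements of [M] and [A], which stay in
       [M]. *)
    have laM j : \sum_i l i * (a i j : grpalg E G) \in M.
      apply: rpred_sum => i _; apply: rpredM (lM i) _.
      by apply: hAM; apply: (valP (a i j)).
    exists (fun j => (\sum_i l i * (a i j : grpalg E G)) *: ext_in (alpha j)).
      by move=> j; exists (\sum_i l i * (a i j : grpalg E G)); first exact: laM.
    under eq_bigr => i _.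
      rewrite xa ext_in_lincomb scaler_sumr; under eq_bigr do rewrite scalerA.
      over.
    by rewrite exchange_big; apply: eq_bigr => j _; rewrite scaler_suml.
  have /choice[m mP] :
      forall i, exists m, m \in M /\ m *: ext_in (alpha i) = v i.
    by move=> i; have [m mM mv] := vM i; exists m.
  exists d, m, alpha; split=> [i|]; first by have [] := mP i.
  by apply: eq_bigr => i _; have [] := mP i.
have [aspan afree] := basis alpha hloc hdsum.
split=> [x|v vA].
  split=> // _; have [a xa] := aspan x.
  by exists (fun i => a i *: alpha i) => // i; exists (a i).
have /choice[a av] : forall i, exists a, a *: alpha i = v i.
  by move=> i; have [a _ av] := vA i; exists a.
under eq_bigr do rewrite -av.
by move=> /afree a0 i; rewrite -av a0 scale0r.
Qed.
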